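(* Let $(\mathsf G,\mathsf E,\mathsf w)$ be a $\mathbf C$-continuation frame on $\mathbf D$. Then the pair $(\Pi[\mathsf G],\pi)$ is an étale space on $\mathbf D$; that is, the projection $\pi\colon\Pi[\mathsf G]\to\mathrm{ob}(\mathbf D)$, $(\phi,S)\mapsto\phi$, is a local homeomorphism.
   Context: $\mathbf D$ is a category whose set of objects $\mathrm{ob}(\mathbf D)$ is a topological space; $\mathbf C$ is a concrete category (equipped with a faithful functor to sets; objects of $\mathbf C$ are treated as sets with structure). A $\mathbf C$-structure on $\mathbf D$ is a contravariant functor $\mathbf D\to\mathbf C$. A $\mathbf C$-structure $\mathsf E$ is considered together with a universe: a constant contravariant functor $\mathsf F\colon\mathbf D\to\mathbf C$ with value $\mathsf F_0$ and an injective natural transformation $\mathsf E\Rightarrow\mathsf F$, by which each $\mathsf E(\phi)$ is regarded as a subset of $\mathsf F_0$. For $U\in\mathsf F_0$ put $\Phi[\mathsf E;U]=\{\phi\in\mathrm{ob}(\mathbf D):U\in\mathsf E(\phi)\}$. $\mathsf E$ is stable if $\Phi[\mathsf E;U]$ is open for every $U\in\mathsf F_0$. A $\mathbf C$-continuation frame on $\mathbf D$ is a triple $(\mathsf G,\mathsf E,\mathsf w)$ of $\mathbf C$-structures $\mathsf E,\mathsf G\colon\mathbf D\to\mathbf C$ and a natural transformation $\mathsf w\colon\mathsf E\Rightarrow\mathsf G$ such that (i) $\mathsf w_\phi\colon\mathsf E(\phi)\to\mathsf G(\phi)$ is surjective for all $\phi$; (ii) $\mathsf E$ is stable; (iii)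 for all $U,U'\in\mathsf F_0$ the set $\{\phi\in\Phi[\mathsf E;U]\cap\Phi[\mathsf E;U']:\mathsf w_\phi(U)=\mathsf w_\phi(U')\}$ is open. $\Pi[\mathsf G]$ is the set of pairs $(\phi,S)$ with $\phi\in\mathrm{ob}(\mathbf D)$, $S\in\mathsf G(\phi)$. For $U\in\mathsf F_0$ define $\Theta[\mathsf w;U]\colon\Phi[\mathsf E;U]\to\Pi[\mathsf G]$, $\phi\mapsto(\phi,\mathsf w_\phi(U))$. $\Pi[\mathsf G]$ carries the topology generated by the sets $\Theta[\mathsf w;U](\Omega)$ with $U\in\mathsf F_0$ and $\Omega\subset\Phi[\mathsf E;U]$ open. *)

(* Defs.v *)
From HB Require Import structures.
From mathcomp Require Import all_boot all_classical all_analysis.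

Set Implicit Arguments.
Unset Strict Implicit.
Unset Printing Implicit Defensive.

Local Open Scope classical_set_scope.

(* A category structure is put on a given type of objects [ob], so that a
   category whose objects form a topological space is a [category T] with
   [T : topologicalType]. [compmor g f] is g after f. *)
Record category (ob : Type) := Category {
  mor : ob -> ob -> Type;
  idmor : forall a, mor a a;
  compmor : forall a b c, mor b c -> mor a b -> mor a c;
  comp_idl : forall a b (f : mor a b), compmor (idmor b) f = f;
  comp_idr : forall a b (f : mor a b), compmor f (idmor a) = f;
  comp_assoc : forall a b c d (h : mor c d) (g : mor b c) (f : mor a b),
    compmor h (compmor g f) = compmor (compmor h g) f }.

Arguments idmor {ob} _ a.
Arguments compmor {ob} _ {a b c} _ _.

Definition opposite (ob : Type) (C : category ob) : category ob :=
  @Category ob (fun a b => mor C b a) (fun a => idmor C a)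
    (fun a b c g f => compmor C f g)
    (fun a b f => comp_idr f)
    (fun a b f => comp_idl f)
    (fun a b c d h g f => esym (comp_assoc f g h)).

Definition types : category Type :=
  @Category Type (fun A B => A -> B) (fun A => id)
    (fun A B C g f => g \o f)
    (fun A B f => erefl) (fun A B f => erefl) (fun A B C D h g f => erefl).

Record functor (obC obD : Type) (C : category obC) (D : category obD) :=
  Functor {
    fobj :> obC -> obD;
    fmor : forall a b, mor C a b -> mor D (fobj a) (fobj b);
    fmor_id : forall a, fmor (idmor C a) = idmor D (fobj a);
    fmor_comp : forall a b c (g : mor C b c) (f : mor C a b),
      fmor (compmor C g f) = compmor D (fmor g) (fmor f) }.

Arguments fmor {obC obD C D} _ {a b} _.

Definition faithful_functor (obC obD : Type) (C : category obC) (D : category obD)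
    (F : functor C D) : Prop :=
  forall a b, injective (@fmor _ _ _ _ F a b).

Definition constant_functor (obC obD : Type) (C : category obC)
    (D : category obD) (d : obD) : functor C D :=
  @Functor obC obD C D (fun=> d) (fun _ _ _ => idmor D d)
    (fun a => erefl) (fun a b c g f => esym (comp_idl (idmor D d))).

Record nat_trans (obC obD : Type) (C : category obC) (D : category obD)
    (F G : functor C D) := NatTrans {
  component :> forall a, mor D (F a) (G a);
  naturality : forall a b (f : mor C a b),
    compmor D (component b) (fmor F f) = compmor D (fmor G f) (component a) }.

Record concrete_category := ConcreteCategory {
  cobj : Type;
  ccat :> category cobj;
  forget : functor ccat types;
  forget_faithful : faithful_functor forget }.

Definition elt (C : concrete_category) (X : cobj C) : Type := forget C X.

Definition appm (C : concrete_category) (X Y : cobj C) (f : mor C X Y) :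
  elt X -> elt Y := fmor (forget C) f.

(* Contravariant functors. *)
Definition cstructure (T : Type) (D : category T) (C : concrete_category) :=
  functor (opposite D) C.

Record universe (T : Type) (D : category T) (C : concrete_category)
    (E : cstructure D C) := Universe {
  univ : cobj C;
  univ_incl : nat_trans E (constant_functor (opposite D) C univ);
  univ_incl_inj : forall phi, injective (appm (univ_incl phi)) }.

(* Membership of [U] in [E phi], the latter viewed as a subset of [univ]. *)
Definition Phi (T : Type) (D : category T) (C : concrete_category)
    (E : cstructure D C) (F : universe E) (U : elt (univ F)) : set T :=
  [set phi | range (appm (univ_incl F phi)) U].

(* [U] itself as an element of [E phi]; unique by [univ_incl_inj]. *)
Definition elt_at (T : Type) (D : category T) (C : concrete_category)
    (E : cstructure D C) (F : universe E) (U : elt (univ F)) (phi : T)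
    (h : Phi U phi) : elt (E phi) :=
  s2val (cid2 h).

Definition stable (T : topologicalType) (D : category T)
    (C : concrete_category) (E : cstructure D C) (F : universe E) : Prop :=
  forall U : elt (univ F), open (Phi U).

Record continuation_frame (T : topologicalType) (D : category T)
    (C : concrete_category) := ContinuationFrame {
  frG : cstructure D C;
  frE : cstructure D C;
  frF : universe frE;
  frw : nat_trans frE frG;
  frw_surj : forall phi (S : elt (frG phi)), exists e, appm (frw phi) e = S;
  frE_stable : stable frF;
  frw_open : forall U U' : elt (univ frF),
    open [set phi | exists (h : Phi U phi) (h' : Phi U' phi),
      appm (frw phi) (elt_at h) = appm (frw phi) (elt_at h')] }.

Section Pi.
Context {T : topologicalType} {D : category T} {C : concrete_category}.
Variable K : continuation_frame D C.

(* The underlying set depends only on [frG K], but the topology depends on the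
   whole frame and its universe. *)
Definition Pi : Type := {phi : T & elt (frG K phi)}.

Definition pi_proj (p : Pi) : T := projT1 p.

(* [Phi U], used as a type, carries the subspace topology. *)
Definition Theta (U : elt (univ (frF K))) (x : Phi U) : Pi :=
  existT (fun phi => elt (frG K phi)) (set_val x)
    (appm (frw K (set_val x)) (elt_at (set_valP x))).

Definition generators : set (set Pi) :=
  [set A | exists (U : elt (univ (frF K))) (Omega : set (Phi U)),
    open Omega /\ A = @Theta U @` Omega].

HB.instance Definition _ := gen_eqMixin Pi.
HB.instance Definition _ := gen_choiceMixin Pi.
HB.instance Definition _ := isSubBaseTopological.Build Pi generators id.

End Pi.

Definition local_homeomorphism (X Y : topologicalType) (f : X -> Y) : Prop :=
  forall x, exists V : set X,
    [/\ open V, V x, open (f @` V) &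
      exists g : Y -> X,
        [/\ {within V, continuous f}, {within f @` V, continuous g} &
            {in V, cancel f g}]].

Definition etale_space (T X : topologicalType) (p : X -> T) : Prop :=
  local_homeomorphism p.

(* Main.v *)
Require Import Defs.
From mathcomp Require Import all_boot all_classical all_analysis.

(** A point of [Pi K] over [phi] is some [w_phi U], because [w_phi] is onto; so
    the sheets [range (Theta U)] cover [Pi K] ([sheets_cover]). The projection
    maps the sheet of [U] bijectively onto [Phi U], with inverse [Theta U]. It
    remains to see that the sheet and its image are open and that both maps are
    continuous.

    The sheets are open by the choice of the topology, and their images
    [Phi U] are open by stability. The part of a sheet that lies over an open
    set of the base is again a generator, and the sheets cover; hence the
    projection is continuous ([continuous_pi_proj]). Continuity of the inverse
    is the only place where condition (iii) is used: the trace of a second sheet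
    on the first one projects to the set where [U] and [U'] have the same image
    under [w], and (iii) says that this set is open
    ([continuous_local_section]). *)

Local Open Scope classical_set_scope.

(** Open sets of [Pi K] are unions of finite intersections of generators, and
    preimages commute with both operations. *)
Lemma continuous_to_Pi {T : topologicalType} {D : category T}
    {C : concrete_category} (K : continuation_frame D C)
    (X : topologicalType) (f : X -> Pi K) :
  (forall A, generators (K := K) A -> open (f @^-1` A)) -> continuous f.
Proof.
move=> fgen; apply/continuousP => _ [B BI <-].
rewrite preimage_bigcup; apply: bigcup_open => _ /BI [s sgen <-].
rewrite preimage_bigcap bigcap_fset big_seq.
apply: (big_ind (@open X)); [exact: openT | exact: openI | move=> A /sgen].
by rewrite inE => /fgen.
Qed.

Section Sheets.
Context {T : topologicalType} {D : category T} {C : concrete_category}.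
Variable K : continuation_frame D C.
Implicit Types (U : elt (univ (frF K))) (p : Pi K) (W : set T).

Lemma elt_atK U (phi : T) (h : Phi U phi) :
  appm (univ_incl (frF K) phi) (elt_at h) = U.
Proof. exact: s2valP' (cid2 h). Qed.

Lemma range_ThetaP U p :
  range (@Theta T D C K U) p <->
  exists h : Phi U (pi_proj p), appm (frw K (pi_proj p)) (elt_at h) = projT2 p.
Proof.
split=> [[x _ <-]|]; first by exists (set_valP x).
case: p => phi S /= [h <-].
exists (SigSub (mem_set h)) => //.
(* [elt_at] takes a membership proof, and any two such proofs are equal. *)
pose q (h0 : Phi U phi) : Pi K := existT _ phi (appm (frw K phi) (elt_at h0)).
exact: (f_equal q (Prop_irrelevance _ h)).
Qed.

(** The generators with parameter [U] are the parts of the sheet of [U] that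
    lie over an open set of the base, so both continuity proofs can handle a
    generator through its projection and its sheet. *)
Lemma Theta_image_preimage U W :
  @Theta T D C K U @` (set_val @^-1` W) =
  @pi_proj T D C K @^-1` W `&` range (@Theta T D C K U).
Proof.
apply/seteqP; split=> [_ [x Wx <-]|p [Wx [x _ xp]]]; first by split=> //; exists x.
by exists x => //; move: Wx; rewrite -xp.
Qed.

(** A germ [S] is [w e] for some [e]; take for [U] the image of [e] in the
    universe. Injectivity of the inclusion ensures that [elt_at] finds [e]
    again. *)
Lemma sheets_cover p : exists U, range (@Theta T D C K U) p.
Proof.
have [e we] := frw_surj (projT2 p).
pose U : elt (univ (frF K)) := appm (univ_incl (frF K) (projT1 p)) e.
have h : Phi U (pi_proj p) by exists e.
exists U; apply/range_ThetaP; exists h; rewrite -we; congr appm.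
exact/univ_incl_inj/elt_atK.
Qed.

Lemma generator_open (A : set (Pi K)) : generators (K := K) A -> open A.
Proof.
move=> genA; exists [set A]; last by rewrite bigcup_set1.
by move=> _ ->; apply: (@finI_from1 _ _ _ id).
Qed.

Lemma open_Theta_image U (Omega : set (Phi U)) :
  open Omega -> open (@Theta T D C K U @` Omega).
Proof. by move=> oOmega; apply: generator_open; exists U, Omega. Qed.

Lemma open_sheet U : open (range (@Theta T D C K U)).
Proof. exact/open_Theta_image/openT. Qed.

Lemma pi_proj_sheet U :
  @pi_proj T D C K @` range (@Theta T D C K U) = Phi U.
Proof.
apply/seteqP; split=> [_ [_ [x _ <-] <-]|phi h]; first exact: set_valP.
by exists (Theta (SigSub (mem_set h) : Phi U)) => //; exists (SigSub (mem_set h)).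
Qed.

Lemma continuous_pi_proj : continuous (@pi_proj T D C K).
Proof.
apply/continuousP => W oW.
have -> : @pi_proj T D C K @^-1` W =
    \bigcup_U @Theta T D C K U @` (set_val @^-1` W).
  apply/seteqP; split=> [p Wp|p [U _]]; rewrite ?Theta_image_preimage; last by case.
  by have [U Up] := sheets_cover p; exists U; rewrite ?Theta_image_preimage.
by apply: bigcup_open => U _; apply: open_Theta_image; exists W.
Qed.

(** [Theta U] extended to the whole base by a junk value [p], since inverses
    are sought among total functions. *)
Definition local_section U p (phi : T) : Pi K :=
  if pselect (Phi U phi) is left h then Theta (SigSub (mem_set h) : Phi U) else p.

Lemma local_sectionE U p (x : Phi U) : local_section U p (set_val x) = Theta x.
Proof.
rewrite /local_section; case: pselect => [h|]; last by have := set_valP x.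
by congr Theta; exact: val_inj.
Qed.

Lemma local_sectionK U p (phi : T) :
  Phi U phi -> pi_proj (local_section U p phi) = phi.
Proof. by move=> h; rewrite (local_sectionE U p (SigSub (mem_set h) : Phi U)). Qed.

(** Over [Phi U], the section [local_section U p] meets the sheet of [U'] above
    the points where [w] identifies [U] and [U'], an open set. *)
Lemma continuous_local_section U p :
  {within Phi U, continuous (local_section U p)}.
Proof.
apply: continuous_to_Pi => _ [U' [_ [[W oW <-] ->]]].
rewrite Theta_image_preimage -open_subspaceIT.
apply: open_subspaceW.
have -> : local_section U p @^-1`
      (@pi_proj T D C K @^-1` W `&` range (@Theta T D C K U')) `&` Phi U =
    W `&` [set phi | exists (h : Phi U phi) (h' : Phi U' phi),
      appm (frw K phi) (elt_at h) = appm (frw K phi) (elt_at h')].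
  apply/seteqP; split=> phi.
    move=> [[+ +] h]; rewrite /= (local_sectionK U p phi h) => Wphi.
    rewrite (local_sectionE U p (SigSub (mem_set h) : Phi U)).
    move=> /range_ThetaP [h' e]; split=> //.
    by exists (set_valP (SigSub (mem_set h) : Phi U)), h'.
  move=> [Wphi [h [h' e]]]; split=> //; split; first by rewrite /= local_sectionK.
  rewrite /= (local_sectionE U p (SigSub (mem_set h) : Phi U)); apply/range_ThetaP.
  exists h'; rewrite -e; congr (appm _ (elt_at _)); exact: Prop_irrelevance.
by apply: openI => //; exact: frw_open.
Qed.

End Sheets.

Theorem theorem4p4 (T : topologicalType) (D : category T)
    (C : concrete_category) (K : continuation_frame D C) :
  etale_space (@pi_proj T D C K).
Proof.
move=> p; have [U Up] := sheets_cover K p.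
exists (range (@Theta T D C K U)).
rewrite pi_proj_sheet; split=> //; [exact: open_sheet | exact: frE_stable |].
exists (local_section K U p); split.
- exact/continuous_subspaceT/continuous_pi_proj.
- exact: continuous_local_section.
- by move=> q /set_mem [x _ <-]; exact: local_sectionE.
Qed.
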